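(* Let $C_2$ be the cyclic group of order $2$ with generator $g$. The operad $Q_{C_2}$ in $C_2$-sets is isomorphic to $\mathbb F\{e,\otimes,\boxtimes\}/\langle R\rangle$, where $\mathbb F\{e,\otimes,\boxtimes\}$ is the free operad in $C_2$-sets on one symbol $e$ of arity $0$ and two symbols $\otimes,\boxtimes$ of arity $2$, and $R$ consists of the following relations: 1. (Strict unit) $\gamma(\boxtimes;\mathbb 1,e)=\gamma(\boxtimes;e,\mathbb 1)=\gamma(\otimes;\mathbb 1,e)=\gamma(\otimes;e,\mathbb 1)=\mathbb 1$; 2. (Strict associativity) for each $\diamondsuit\in\{\otimes,\boxtimes\}$ (the symbols naming the primitive elements of $Q_{C_2}(2)$), $\gamma(\diamondsuit;\diamondsuit,\mathbb 1)=\gamma(\diamondsuit;\mathbb 1,\diamondsuit)$; 3. (Group action) $g\cdot\boxtimes=\boxtimes\cdot(1\ 2)$, $g\cdot\otimes=\otimes$, and $g\cdot e=e$.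
   Context: **Permutations.** $\Sigma_n$ is the symmetric group on $\{1,\dots,n\}$, with product $\sigma\tau$ meaning ''first $\tau$, then $\sigma$''. For $\sigma\in\Sigma_n$ and $k_1,\dots,k_n\ge 0$ with $k=k_1+\dots+k_n$, split $\{1,\dots,k\}$ into $n$ consecutive (possibly empty) blocks of sizes $k_1,\dots,k_n$. The block permutation $\sigma\langle k_1,\dots,k_n\rangle\in\Sigma_k$ permutes the blocks according to $\sigma$: it sends the $i$-th element of the $j$-th block to $i+\sum_{l:\sigma(l)<\sigma(j)}k_l$. For $\tau_j\in\Sigma_{k_j}$, the block sum $\tau_1\oplus\dots\oplus\tau_n\in\Sigma_k$ permutes by $\tau_j$ within the $j$-th block. Put $\sigma\langle\tau_1,\dots,\tau_n\rangle=\sigma\langle k_1,\dots,k_n\rangle\cdot(\tau_1\oplus\dots\oplus\tau_n)$. **The operad $P_G$.** For a finite group $G$, $P_G$ is the (symmetric) operad in $G$-sets with $P_G(n)$ the set of all functions $f\colon G\to\Sigma_n$ (not necessarily homomorphisms), for $n\ge 0$. The left $G$-action is $(g\cdot f)(h)=f(hg)$, the right $\Sigma_n$-action is $(f\cdot\sigma)(h)=f(h)\sigma$, the composition is $\gamma(f;f_1,\dots,f_n)(h)=f(h)\langle f_1(h),\dots,f_n(h)\rangle$, and the operadic identity is the unique element $\mathbb 1\in P_G(1)$. An element $f\in P_G(n)$ is *primitive* if $f(1_G)=1_{\Sigma_n}$. **$Q_{C_2}$.** $Q_{C_2}\subseteq P_{C_2}$ is the smallest suboperad (levelwise subsets closed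 under the $C_2$- and $\Sigma_n$-actions, containing $\mathbb 1$, and closed under $\gamma$) containing the three elements: $e\in P_{C_2}(0)$, the unique element; $\otimes\in P_{C_2}(2)$, the constant function at $1_{\Sigma_2}$; and $\boxtimes\in P_{C_2}(2)$, with $\boxtimes(1_{C_2})=1_{\Sigma_2}$ and $\boxtimes(g)=(1\ 2)$. **Free operads and quotients.** The free operad $\mathbb F S$ in $G$-sets on a sequence of sets $S=\{S_n\}_{n\ge0}$ is the operad in $G$-sets such that operad maps (levelwise $G$- and $\Sigma_n$-equivariant maps preserving identity and composition) $\mathbb F S\to\mathcal O$ correspond to families of functions $S_n\to\mathcal O(n)$; concretely its elements are isomorphism classes of finite rooted planar trees with $k$-ary nodes labeled by $G\times S_k$, together with a permutation of the leaves. A *congruence relation* on an operad $\mathcal O$ in $G$-sets is a family of equivalence relations $\sim_n$ on $\mathcal O(n)$, $n\ge 0$, respecting the $G$- and $\Sigma_n$-actions and operadic composition. For a graded binary relation $R$ on $\mathcal O$, $\langle R\rangle$ is the smallest congruence relation containing $R$, and $\mathcal O/\langle R\rangle$ is the quotient operad. A relation written as an equation $x=y$ means that the pair $(x,y)$ is in $R$. *)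

(* Defs.v *)
From mathcomp Require Import all_boot all_order all_fingroup.
From mathcomp Require Import boolp.

Set Implicit Arguments.
Unset Strict Implicit.
Unset Printing Implicit Defensive.

(** The set {1, ..., k_1 + ... + k_n} is ['I_(\sum_i k i)], and
    [tagnat.Rank j i] is the [i]-th element of its [j]-th block.

    Pitfall: in MathComp [(s * t)%g] is "first [s], then [t]"; the product of
    symmetric groups used here is the opposite one, "first [t], then [s]".
    Hence the macro [s \oS t]. *)

Notation "s \oS t" := (t * s)%g (at level 40, left associativity, only parsing).

Section BlockPermutations.

Variables (n : nat) (k : 'I_n -> nat).

Lemma Rank_surj (x : 'I_(\sum_i k i)) :
  exists j, exists i : 'I_(k j), x = tagnat.Rank j i.
Proof. by exists (tagnat.sig1 x), (tagnat.sig2 x); rewrite tagnat.sig2K. Qed.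

Lemma offset_step (s : 'S_n) (j : 'I_n) :
  \sum_(l | s l < s j) k l + k j = \sum_(l | s l <= s j) k l.
Proof.
rewrite [RHS](bigD1 j) //= addnC; congr (_ + _); apply: eq_bigl => l.
rewrite ltn_neqAle andbC; congr (_ && _).
by rewrite -(inj_eq (@perm_inj _ s) l j) -val_eqE.
Qed.

Lemma leq_sum_pred (P Q : pred 'I_n) :
  (forall l, P l -> Q l) -> \sum_(l | P l) k l <= \sum_(l | Q l) k l.
Proof.
move=> PQ; rewrite [leqRHS](bigID P) /= -[leqLHS]addn0 leq_add //.
rewrite leq_eqVlt; apply/orP; left; apply/eqP; apply: eq_bigl => l.
by case: (boolP (P l)) => [/PQ ->|]; rewrite ?andbF.
Qed.

Lemma block_bound (s : 'S_n) (x : 'I_(\sum_i k i)) :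
  \sum_(l | s l < s (tagnat.sig1 x)) k l + tagnat.sig2 x < \sum_i k i.
Proof.
apply: (@leq_trans (\sum_(l | s l <= s (tagnat.sig1 x)) k l)).
  by rewrite -offset_step ltn_add2l.
exact: leq_sum_pred.
Qed.

Definition block_fun (s : 'S_n) (x : 'I_(\sum_i k i)) : 'I_(\sum_i k i) :=
  Ordinal (block_bound s x).

Lemma block_funE (s : 'S_n) j (i : 'I_(k j)) :
  block_fun s (tagnat.Rank j i) = \sum_(l | s l < s j) k l + i :> nat.
Proof.
have E : tagnat.sig (tagnat.Rank j i) = Tagged (fun j => 'I_(k j)) i.
  exact: tagnat.rankK.
by rewrite /= /tagnat.sig2 /tagnat.sig1 E.
Qed.

Lemma block_lt (s : 'S_n) j j' (i : 'I_(k j)) (m : nat) : s j < s j' ->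
  \sum_(l | s l < s j) k l + i < \sum_(l | s l < s j') k l + m.
Proof.
move=> lt_jj'; apply: (@leq_trans (\sum_(l | s l <= s j) k l)).
  by rewrite -offset_step ltn_add2l.
apply: leq_trans (leq_addr _ _); apply: leq_sum_pred => l.
by move=> /leq_ltn_trans; apply.
Qed.

Lemma block_fun_inj (s : 'S_n) : injective (block_fun s).
Proof.
move=> x y.
have [j [i ->]] := Rank_surj x; have [j' [i' ->]] := Rank_surj y.
move=> /(congr1 val); rewrite [val _]block_funE [val _ in RHS]block_funE => E.
case: (ltngtP (s j) (s j')) => [/(block_lt i i')|/(block_lt i' i)|].
- by rewrite E ltnn.
- by rewrite E ltnn.
move=> /val_inj /perm_inj jj'; case: _ / jj' in i' E *.
by move/eqP: E; rewrite eqn_add2l => /eqP /val_inj ->.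
Qed.

Definition block_perm (s : 'S_n) : 'S_(\sum_i k i) := perm (@block_fun_inj s).

Definition block_sum_fun (t : forall j, 'S_(k j)) (x : 'I_(\sum_i k i)) :
  'I_(\sum_i k i) := tagnat.Rank _ (t (tagnat.sig1 x) (tagnat.sig2 x)).

Lemma block_sum_funE (t : forall j, 'S_(k j)) j (i : 'I_(k j)) :
  block_sum_fun t (tagnat.Rank j i) = tagnat.Rank j (t j i).
Proof.
have E : tagnat.sig (tagnat.Rank j i) = Tagged (fun j => 'I_(k j)) i.
  exact: tagnat.rankK.
by rewrite /block_sum_fun /tagnat.sig2 /tagnat.sig1 E.
Qed.

Lemma block_sum_fun_inj (t : forall j, 'S_(k j)) : injective (block_sum_fun t).
Proof.
move=> x y.
have [j [i ->]] := Rank_surj x; have [j' [i' ->]] := Rank_surj y.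
rewrite !block_sum_funE => /(congr1 val)/eqP; rewrite tagnat.eq_Rank.
case/andP => /eqP jj'; case: _ / jj' in i' *.
by move=> /eqP /val_inj /perm_inj ->.
Qed.

Definition block_sum (t : forall j, 'S_(k j)) : 'S_(\sum_i k i) :=
  perm (@block_sum_fun_inj t).

Definition wreath (s : 'S_n) (t : forall j, 'S_(k j)) : 'S_(\sum_i k i) :=
  block_perm s \oS block_sum t.

Lemma block_permE (s : 'S_n) j (i : 'I_(k j)) :
  block_perm s (tagnat.Rank j i) = \sum_(l | s l < s j) k l + i :> nat.
Proof. by rewrite permE block_funE. Qed.

Lemma block_sumE (t : forall j, 'S_(k j)) j (i : 'I_(k j)) :
  block_sum t (tagnat.Rank j i) = tagnat.Rank j (t j i).
Proof. by rewrite permE block_sum_funE. Qed.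

Lemma wreathE (s : 'S_n) (t : forall j, 'S_(k j)) j (i : 'I_(k j)) :
  wreath s t (tagnat.Rank j i) = \sum_(l | s l < s j) k l + t j i :> nat.
Proof. by rewrite permM block_sumE block_permE. Qed.

Lemma wreath_lt (s : 'S_n) (t : forall j, 'S_(k j)) j j' (i : 'I_(k j))
    (i' : 'I_(k j')) : s j != s j' ->
  (wreath s t (tagnat.Rank j i) < wreath s t (tagnat.Rank j' i')) =
  (s j < s j').
Proof.
rewrite !wreathE -val_eqE; case: (ltngtP (s j) (s j')) => // + _.
  exact: block_lt.
by move=> /(block_lt (t j' i') (t j i)) /ltnW; rewrite ltnNge => ->.
Qed.

Lemma wreath_lt_eq (s : 'S_n) (t : forall j, 'S_(k j)) j (i i' : 'I_(k j)) :
  (wreath s t (tagnat.Rank j i) < wreath s t (tagnat.Rank j i')) =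
  (t j i < t j i').
Proof. by rewrite !wreathE ltn_add2l. Qed.

End BlockPermutations.

Lemma wreath1 n (k : 'I_n -> nat) x :
  wreath (1%g : 'S_n) (fun j => 1%g : 'S_(k j)) x = x.
Proof.
have [j [i ->]] := Rank_surj x; apply: ord_inj.
rewrite wreathE tagnat.RankEsum !perm1; congr (_ + _).
by apply: eq_bigl => l; rewrite !perm1.
Qed.

Lemma sum_Rank n (k : 'I_n -> nat) (P : pred 'I_(\sum_i k i)) F :
  \sum_(v | P v) F v =
  \sum_j \sum_(i | P (tagnat.Rank j i)) F (tagnat.Rank j i).
Proof.
rewrite (reindex (@tagnat.rank n k)) /=; last exact/onW_bij/tagnat.rank_bij.
by rewrite sig_big_dep; apply: eq_big => [p|p _]; rewrite tagnat.rankE.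
Qed.

Lemma wreath_offset n (k : 'I_n -> nat) (l : 'I_(\sum_i k i) -> nat)
    (s : 'S_n) (t : forall j, 'S_(k j)) j (i : 'I_(k j)) :
  \sum_(v | wreath s t v < wreath s t (tagnat.Rank j i)) l v =
  \sum_(j' | s j' < s j) \sum_i' l (tagnat.Rank j' i') +
  \sum_(i' | t j i' < t j i) l (tagnat.Rank j i').
Proof.
rewrite sum_Rank (bigID (fun j' => s j' < s j)) /=; congr (_ + _).
  apply: eq_bigr => j' ltj; apply: eq_bigl => i'.
  by rewrite wreath_lt // neq_ltn ltj.
rewrite (bigD1 j) ?ltnn //= [X in _ + X]big1 ?addn0 => [|j' /andP[gej nej]].
  by apply: eq_bigl => i'; rewrite wreath_lt_eq.
apply: big_pred0 => i'; rewrite wreath_lt ?(negbTE gej) //.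
by rewrite (inj_eq perm_inj).
Qed.

Lemma Rank_offset n (k : 'I_n -> nat) (l : 'I_(\sum_i k i) -> nat) j
    (i : 'I_(k j)) :
  \sum_(v : 'I_(\sum_i k i) | v < tagnat.Rank j i) l v =
  \sum_(j' : 'I_n | j' < j) \sum_i' l (tagnat.Rank j' i') +
  \sum_(i' : 'I_(k j) | i' < i) l (tagnat.Rank j i').
Proof.
transitivity (\sum_(v | wreath (1%g : 'S_n) (fun j => 1%g : 'S_(k j)) v <
    wreath (1%g : 'S_n) (fun j => 1%g : 'S_(k j)) (tagnat.Rank j i)) l v).
  by apply: eq_bigl => v; rewrite !wreath1.
rewrite wreath_offset; congr (_ + _); apply: eq_bigl => ?; by rewrite !perm1.
Qed.

Lemma sum_lt_perm n (s : 'S_n) (j : 'I_n) : \sum_(l | s l < s j) 1 = s j.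
Proof.
rewrite -[RHS]card_ord -sum1_card (big_ord_widen n (fun=> 1)); last first.
  by rewrite ltnW.
by rewrite [RHS](reindex_inj (@perm_inj _ s)).
Qed.

(** Arities that agree only propositionally are identified by transport along
    a proof of their equality. *)

Definition ocast (T : nat -> Type) m n (e : m = n) (x : T m) : T n :=
  eq_rect m T x n e.

Record operad_data (G : finGroupType) := OperadData {
  op_car :> nat -> Type;
  gact : forall n, G -> op_car n -> op_car n;
  sact : forall n, op_car n -> 'S_n -> op_car n;
  opid : op_car 1;
  comp : forall n (k : 'I_n -> nat),
    op_car n -> (forall i, op_car (k i)) -> op_car (\sum_i k i) }.

Arguments gact {G o n}.
Arguments sact {G o n}.
Arguments opid {G o}.
Arguments comp {G o n k}.

Record is_congruence (G : finGroupType) (D : operad_data G)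
    (E : forall n, D n -> D n -> Prop) : Prop := IsCongruence {
  cong_refl : forall n (x : D n), E n x x;
  cong_sym : forall n (x y : D n), E n x y -> E n y x;
  cong_trans : forall n (x y z : D n), E n x y -> E n y z -> E n x z;
  cong_gact : forall n (g : G) (x y : D n), E n x y -> E n (gact g x) (gact g y);
  cong_sact : forall n (x y : D n) (s : 'S_n),
    E n x y -> E n (sact x s) (sact y s);
  cong_comp : forall n (k : 'I_n -> nat) (x x' : D n) (y y' : forall i, D (k i)),
    E n x x' -> (forall i, E (k i) (y i) (y' i)) ->
    E (\sum_i k i) (comp x y) (comp x' y') }.

Record congruence (G : finGroupType) (D : operad_data G) := Congruence {
  cong_rel :> forall n, D n -> D n -> Prop;
  congP : is_congruence cong_rel }.

(** The operad axioms, stated up to a relation [E]: with [E] equality they are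
    the axioms of operads, and the same list presents free operads below. *)
Record operad_laws (G : finGroupType) (D : operad_data G)
    (E : forall n, D n -> D n -> Prop) : Prop := OperadLaws {
  law_gact1 : forall n (x : D n), E n (gact 1%g x) x;
  law_gactM : forall n (g h : G) (x : D n),
    E n (gact (g * h)%g x) (gact g (gact h x));
  law_sact1 : forall n (x : D n), E n (sact x 1%g) x;
  law_sactM : forall n (x : D n) (s t : 'S_n),
    E n (sact x (s \oS t)) (sact (sact x s) t);
  law_gsact : forall n (g : G) (x : D n) (s : 'S_n),
    E n (gact g (sact x s)) (sact (gact g x) s);
  law_gopid : forall g : G, E 1 (gact g opid) opid;
  law_gcomp : forall n (k : 'I_n -> nat) (g : G) (x : D n) (y : forall i, D (k i)),
    E (\sum_i k i) (gact g (comp x y)) (comp (gact g x) (fun i => gact g (y i)));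
  law_idl : forall n (x : D n) (e : n = \sum_(i < 1) n),
    E (\sum_(i < 1) n) (comp opid (fun _ : 'I_1 => x)) (ocast e x);
  law_idr : forall n (x : D n) (e : n = \sum_(i < n) 1),
    E (\sum_(i < n) 1) (comp x (fun _ : 'I_n => opid)) (ocast e x);
  law_assoc : forall n (k : 'I_n -> nat) (l : 'I_(\sum_i k i) -> nat)
      (x : D n) (y : forall i, D (k i)) (z : forall u, D (l u))
      (e : \sum_i \sum_j l (tagnat.Rank i j) = \sum_u l u),
    E (\sum_u l u) (comp (comp x y) z)
      (ocast e (comp x (fun i => comp (y i) (fun j => z (tagnat.Rank i j)))));
  (* (x . s)(y_s(1), ..., y_s(n)) = x(y_1, ..., y_n) . s<k_s(1), ..., k_s(n)> *)
  law_equivl : forall n (k : 'I_n -> nat) (x : D n) (s : 'S_n)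
      (y : forall i, D (k i)) (e : \sum_i k i = \sum_i k (s i)),
    E (\sum_i k (s i)) (comp (sact x s) (fun i => y (s i)))
      (sact (ocast e (comp x y)) (block_perm (fun i => k (s i)) s));
  law_equivr : forall n (k : 'I_n -> nat) (x : D n) (y : forall i, D (k i))
      (t : forall i, 'S_(k i)),
    E (\sum_i k i) (comp x (fun i => sact (y i) (t i)))
      (sact (comp x y) (block_sum t)) }.

Record operad (G : finGroupType) := Operad {
  op_data :> operad_data G;
  opP : operad_laws (fun n (x y : op_data n) => x = y) }.

Record operad_map (G : finGroupType) (O O' : operad_data G) := OperadMap {
  op_fun :> forall n, O n -> O' n;
  map_gact : forall n (g : G) (x : O n), op_fun (gact g x) = gact g (op_fun x);
  map_sact : forall n (x : O n) (s : 'S_n),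
    op_fun (sact x s) = sact (op_fun x) s;
  map_opid : op_fun (@opid G O) = opid;
  map_comp : forall n (k : 'I_n -> nat) (x : O n) (y : forall i, O (k i)),
    op_fun (comp x y) = comp (op_fun x) (fun i => op_fun (y i)) }.

Definition isomorphic (G : finGroupType) (O O' : operad G) : Prop :=
  exists f : operad_map O O', forall n, bijective (@op_fun _ _ _ f n).

Lemma sig_sval_inj (T : Type) (P : T -> Prop) (u v : {x : T | P x}) :
  sval u = sval v -> u = v.
Proof. by case: u v => [x px] [y py] /=; apply: eq_exist. Qed.

Lemma op_fun_cast (T T' : nat -> Type) (f : forall n, T n -> T' n) m n
  (e : m = n) (x : T m) : f n (ocast e x) = ocast e (f m x).
Proof. by case: _ / e. Qed.

(** Binary composites [gamma(x; y, z)]. *)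

Definition arity2 (p q : nat) (i : 'I_2) : nat := if i == ord0 then p else q.

Definition family2 (T : nat -> Type) p q (y : T p) (z : T q) (i : 'I_2) :
    T (arity2 p q i) :=
  if i == ord0 as b return T (if b then p else q) then y else z.

Lemma sum_arity2 p q : \sum_i arity2 p q i = p + q.
Proof. by rewrite !big_ord_recl big_ord0 addn0. Qed.

Definition comp2 (G : finGroupType) (D : operad_data G) p q (x : D 2) (y : D p)
    (z : D q) : D (p + q) :=
  ocast (sum_arity2 p q) (comp x (family2 y z)).

Section Smallest.

Variables (G : finGroupType) (D : operad_data G) (C : congruence D -> Prop).

Definition smallest_rel n (x y : D n) : Prop :=
  forall E : congruence D, C E -> E n x y.

Lemma smallest_relP : is_congruence smallest_rel.
Proof.
split.
- by move=> n x E _; apply: (cong_refl (congP E)).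
- by move=> n x y xy E CE; apply: (cong_sym (congP E)); apply: xy.
- move=> n x y z xy yz E CE.
  by apply: (cong_trans (congP E) (y := y)); [apply: xy | apply: yz].
- by move=> n g x y xy E CE; apply: (cong_gact (congP E)); apply: xy.
- by move=> n x y s xy E CE; apply: (cong_sact (congP E)); apply: xy.
- move=> n k x x' y y' xx' yy' E CE.
  by apply: (cong_comp (congP E)) => [|i]; [apply: xx' | apply: yy'].
Qed.

Definition smallest_congruence : congruence D := Congruence smallest_relP.

End Smallest.

Definition generated_congruence (G : finGroupType) (D : operad_data G)
    (R : forall n, D n -> D n -> Prop) : congruence D :=
  smallest_congruence (fun E => forall n (x y : D n), R n x y -> E n x y).

Section Quotient.

Variables (G : finGroupType) (D : operad_data G) (E : congruence D).

Definition quot_car (n : nat) : Type :=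
  {A : D n -> Prop | exists x, A = E n x}.

Definition quot_cls n (x : D n) : quot_car n :=
  exist _ (E n x) (ex_intro _ x erefl).

Definition quot_repr n (q : quot_car n) : D n := sval (cid (svalP q)).

Lemma quot_reprK n (q : quot_car n) : quot_cls (quot_repr q) = q.
Proof. by apply: sig_sval_inj; rewrite /= /quot_repr; case: cid. Qed.

Lemma quot_clsP n (x y : D n) : quot_cls x = quot_cls y <-> E n x y.
Proof.
have EP := congP E; split=> [/(congr1 sval) /= Exy|Exy].
  by rewrite Exy; apply: (cong_refl EP).
apply: sig_sval_inj; apply/funext => z; apply/propext; split => Ez.
  exact: (cong_trans EP (cong_sym EP Exy) Ez).
exact: (cong_trans EP Exy Ez).
Qed.

Lemma quot_repr_cls n (x : D n) : E n (quot_repr (quot_cls x)) x.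
Proof. by apply/quot_clsP; rewrite quot_reprK. Qed.

(** Operations are computed on representatives; that the choice is immaterial
    is [quot_gact], [quot_sact] and [quot_comp]. *)
Definition quot_data : operad_data G := {|
  op_car := quot_car;
  gact := fun n g q => quot_cls (gact g (quot_repr q));
  sact := fun n q s => quot_cls (sact (quot_repr q) s);
  opid := quot_cls opid;
  comp := fun n k q r =>
    quot_cls (comp (quot_repr q) (fun i => quot_repr (r i))) |}.

Lemma quot_gact n (g : G) (x : D n) :
  gact g (quot_cls x : quot_data n) = quot_cls (gact g x).
Proof. by apply/quot_clsP/(cong_gact (congP E))/quot_repr_cls. Qed.

Lemma quot_sact n (x : D n) (s : 'S_n) :
  sact (quot_cls x : quot_data n) s = quot_cls (sact x s).
Proof. by apply/quot_clsP/(cong_sact (congP E))/quot_repr_cls. Qed.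

Lemma quot_comp n (k : 'I_n -> nat) (x : D n) (y : forall i, D (k i)) :
  comp (quot_cls x : quot_data n) (fun i => quot_cls (y i) : quot_data (k i)) =
  quot_cls (comp x y).
Proof.
apply/quot_clsP/(cong_comp (congP E)); first exact: quot_repr_cls.
by move=> i; apply: quot_repr_cls.
Qed.

Lemma quot_comp_fam n (k : 'I_n -> nat) (x : D n)
    (r : forall i, quot_data (k i)) (y : forall i, D (k i)) :
  (forall i, r i = quot_cls (y i)) ->
  comp (quot_cls x : quot_data n) r = quot_cls (comp x y).
Proof.
move=> ry; have -> : r = fun i => quot_cls (y i).
  exact: functional_extensionality_dep.
exact: quot_comp.
Qed.

Lemma quot_cast m n (e : m = n) (x : D m) :
  ocast e (quot_cls x : quot_data m) = quot_cls (ocast e x).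
Proof. by case: _ / e. Qed.

Lemma quot_surj n (q : quot_data n) : exists x : D n, q = quot_cls x.
Proof. by exists (quot_repr q); rewrite quot_reprK. Qed.

Lemma quot_fam_surj n (k : 'I_n -> nat) (r : forall i, quot_data (k i)) :
  exists y : forall i, D (k i), r = fun i => quot_cls (y i).
Proof.
exists (fun i => quot_repr (r i)); apply: functional_extensionality_dep => i.
by rewrite quot_reprK.
Qed.

Lemma quot_laws :
  operad_laws E -> operad_laws (fun n (x y : quot_data n) => x = y).
Proof.
move=> L; split.
- move=> n q; have [x ->] := quot_surj q; rewrite quot_gact.
  exact/quot_clsP/(law_gact1 L).
- move=> n g h q; have [x ->] := quot_surj q; rewrite !quot_gact.
  exact/quot_clsP/(law_gactM L).
- move=> n q; have [x ->] := quot_surj q; rewrite quot_sact.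
  exact/quot_clsP/(law_sact1 L).
- move=> n q s t; have [x ->] := quot_surj q; rewrite !quot_sact.
  exact/quot_clsP/(law_sactM L).
- move=> n g q s; have [x ->] := quot_surj q.
  rewrite quot_gact !quot_sact quot_gact.
  exact/quot_clsP/(law_gsact L).
- by move=> g; rewrite quot_gact; apply/quot_clsP/(law_gopid L).
- move=> n k g q r; have [x ->] := quot_surj q.
  have [y ->] := quot_fam_surj r; rewrite quot_comp !quot_gact.
  rewrite (quot_comp_fam _ (fun i => quot_gact g (y i))).
  exact/quot_clsP/(law_gcomp L).
- move=> n q e; have [x ->] := quot_surj q; rewrite quot_cast quot_comp.
  exact/quot_clsP/(law_idl L).
- move=> n q e; have [x ->] := quot_surj q; rewrite quot_cast quot_comp.
  exact/quot_clsP/(law_idr L).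
- move=> n k l q r w e; have [x ->] := quot_surj q.
  have [y ->] := quot_fam_surj r; have [z ->] := quot_fam_surj w.
  rewrite (quot_comp x y) (quot_comp (comp x y) z).
  rewrite (@quot_comp_fam _ _ x _
    (fun i => comp (y i) (fun j => z (tagnat.Rank i j)))).
    by rewrite quot_cast; apply/quot_clsP/(law_assoc L).
  by move=> i; apply: quot_comp.
- move=> n k q s r e; have [x ->] := quot_surj q.
  have [y ->] := quot_fam_surj r.
  rewrite quot_sact (quot_comp x y).
  rewrite (@quot_comp_fam _ _ (sact x s) _ (fun i => y (s i))) //.
  rewrite quot_cast quot_sact.
  exact/quot_clsP/(law_equivl L).
- move=> n k q r t; have [x ->] := quot_surj q.
  have [y ->] := quot_fam_surj r.
  rewrite (quot_comp_fam _ (fun i => quot_sact (y i) (t i))).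
  by rewrite quot_comp quot_sact; apply/quot_clsP/(law_equivr L).
Qed.

End Quotient.

Arguments quot_cls {G D} E {n} x.
Arguments quot_repr {G D} E {n} q.

Lemma laws_weaken (G : finGroupType) (O : operad G) (E : congruence O) :
  operad_laws E.
Proof.
have EP := congP E; have L := opP O.
split=> *;
  [ rewrite (law_gact1 L) | rewrite (law_gactM L) | rewrite (law_sact1 L)
  | rewrite (law_sactM L) | rewrite (law_gsact L) | rewrite (law_gopid L)
  | rewrite (law_gcomp L) | rewrite -(law_idl L) | rewrite -(law_idr L)
  | rewrite -(law_assoc L) | rewrite -(law_equivl L) | rewrite (law_equivr L) ];
  exact: (cong_refl EP).
Qed.

Definition quotient_operad (G : finGroupType) (O : operad G)
    (E : congruence O) : operad G := Operad (quot_laws (laws_weaken E)).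

(** Free operads: formal composites of generators, modulo the smallest
    congruence enforcing the operad axioms; [free_operadP] is the universal
    property. *)

Section Free.

Variables (G : finGroupType) (S : nat -> Type).

Inductive term : nat -> Type :=
| Gen n of S n : term n
| Act n of G & term n : term n
| Sym n of term n & 'S_n : term n
| Id : term 1
| Comp n (k : 'I_n -> nat) of term n & (forall i, term (k i)) :
    term (\sum_i k i).

Definition term_data : operad_data G := {|
  op_car := term; gact := Act; sact := Sym; opid := Id; comp := Comp |}.

Definition term_congruence : congruence term_data :=
  smallest_congruence (fun E => operad_laws E).

Lemma term_laws : operad_laws term_congruence.
Proof. by split=> * E L; case: (L). Qed.

Definition free_operad : operad G := Operad (quot_laws term_laws).

Definition free_gen n (s : S n) : free_operad n :=
  quot_cls term_congruence (Gen s).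

Fixpoint term_eval (O : operad G) (u : forall n, S n -> O n) n (t : term n) :
    O n :=
  match t in term m return O m with
  | Gen _ s => u _ s
  | Act _ g t => gact g (term_eval u t)
  | Sym _ t s => sact (term_eval u t) s
  | Id => opid
  | Comp _ _ t t' => comp (term_eval u t) (fun i => term_eval u (t' i))
  end.

Section Eval.

Variables (O : operad G) (u : forall n, S n -> O n).

Definition ker_rel n (x y : term_data n) : Prop :=
  term_eval u x = term_eval u y.

Lemma ker_relP : is_congruence ker_rel.
Proof.
rewrite /ker_rel; split=> //=.
- by move=> n x y z -> ->.
- by move=> n g x y ->.
- by move=> n x y s ->.
- move=> n k x x' y y' -> yy'; congr comp.
  exact: functional_extensionality_dep.
Qed.

Lemma ker_laws : operad_laws (Congruence ker_relP).
Proof.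
have L := opP O; have castE := op_fun_cast (@term_eval O u).
split=> *; rewrite /= /ker_rel /= ?castE /=.
- exact: (law_gact1 L).
- exact: (law_gactM L).
- exact: (law_sact1 L).
- exact: (law_sactM L).
- exact: (law_gsact L).
- exact: (law_gopid L).
- exact: (law_gcomp L).
- exact: (law_idl L).
- exact: (law_idr L).
- exact: (law_assoc L).
- exact: (law_equivl L).
- exact: (law_equivr L).
Qed.

Definition free_fun n (x : free_operad n) : O n :=
  term_eval u (quot_repr term_congruence x).

Lemma free_fun_cls n (t : term_data n) :
  free_fun (quot_cls term_congruence t) = term_eval u t.
Proof.
have H : smallest_rel _ _ _ := quot_repr_cls term_congruence t.
exact: (H (Congruence ker_relP) ker_laws).
Qed.

Definition free_map : operad_map free_operad O.
Proof.
exists free_fun.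
- by move=> n g x; apply: free_fun_cls.
- by move=> n x s; apply: free_fun_cls.
- exact: free_fun_cls.
- by move=> n k x y; apply: free_fun_cls.
Defined.

End Eval.

Lemma free_operadP (O : operad G) (u : forall n, S n -> O n) :
  exists f : operad_map free_operad O,
    (forall n (s : S n), f n (free_gen s) = u n s) /\
    (forall f' : operad_map free_operad O,
       (forall n (s : S n), f' n (free_gen s) = u n s) ->
       forall n (x : free_operad n), f' n x = f n x).
Proof.
exists (free_map u); split=> [n s|f' f'u n x]; first exact: free_fun_cls.
have [t ->] := quot_surj x; rewrite /= free_fun_cls.
elim: t => {n x} [n s|n g t IH|n t IH s||n k t IH t' IH'] /=.
- exact: f'u.
- by rewrite -IH -map_gact; congr (f' _ _); apply/esym/quot_gact.
- by rewrite -IH -map_sact; congr (f' _ _); apply/esym/quot_sact.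
- exact: (map_opid f').
- rewrite -IH -(functional_extensionality_dep IH').
  by rewrite -map_comp; congr (f' _ _); apply/esym/quot_comp.
Qed.

End Free.

Record is_suboperad (G : finGroupType) (D : operad_data G)
    (A : forall n, D n -> Prop) : Prop := IsSuboperad {
  sub_gact : forall n (g : G) (x : D n), A n x -> A n (gact g x);
  sub_sact : forall n (x : D n) (s : 'S_n), A n x -> A n (sact x s);
  sub_opid : A 1 opid;
  sub_comp : forall n (k : 'I_n -> nat) (x : D n) (y : forall i, D (k i)),
    A n x -> (forall i, A (k i) (y i)) -> A (\sum_i k i) (comp x y) }.

Section Suboperad.

Variables (G : finGroupType) (O : operad G) (A : forall n, O n -> Prop).
Variable AP : is_suboperad A.

Definition sub_data : operad_data G := {|
  op_car := fun n => {x : O n | A x};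
  gact := fun n g x => exist _ (gact g (sval x)) (sub_gact AP g (svalP x));
  sact := fun n x s => exist _ (sact (sval x) s) (sub_sact AP s (svalP x));
  opid := exist _ opid (sub_opid AP);
  comp := fun n k x y => exist _ (comp (sval x) (fun i => sval (y i)))
    (sub_comp AP (svalP x) (fun i => svalP (y i))) |}.

Lemma sub_laws : operad_laws (fun n (x y : sub_data n) => x = y).
Proof.
have L := opP O.
have castE := op_fun_cast (T := sub_data) (fun n (x : sub_data n) => sval x).
split=> *; apply: sig_sval_inj => /=; rewrite ?castE /=.
- exact: (law_gact1 L).
- exact: (law_gactM L).
- exact: (law_sact1 L).
- exact: (law_sactM L).
- exact: (law_gsact L).
- exact: (law_gopid L).
- exact: (law_gcomp L).
- exact: (law_idl L).
- exact: (law_idr L).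
- exact: (law_assoc L).
- exact: (law_equivl L).
- exact: (law_equivr L).
Qed.

Definition suboperad : operad G := Operad sub_laws.

End Suboperad.

Section GeneratedSuboperad.

Variables (G : finGroupType) (O : operad G) (X : forall n, O n -> Prop).

Definition generated_sub n (x : O n) : Prop :=
  forall A : forall n, O n -> Prop, is_suboperad A ->
    (forall m (y : O m), X y -> A m y) -> A n x.

Lemma generated_subP : is_suboperad generated_sub.
Proof.
split.
- by move=> n g x Ax A AP XA; apply: (sub_gact AP); apply: Ax.
- by move=> n x s Ax A AP XA; apply: (sub_sact AP); apply: Ax.
- by move=> A AP XA; apply: (sub_opid AP).
- move=> n k x y Ax Ay A AP XA.
  by apply: (sub_comp AP) => [|i]; [apply: Ax | apply: Ay].
Qed.

Definition generated_suboperad : operad G := suboperad generated_subP.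

End GeneratedSuboperad.

Section Permutativity.

Variable G : finGroupType.

Definition perm_data : operad_data G := {|
  op_car := fun n => {ffun G -> 'S_n};
  gact := fun n g f => [ffun h => f (h * g)%g];
  sact := fun n f s => [ffun h => f h \oS s];
  opid := [ffun => 1%g];
  comp := fun n k f F => [ffun h => wreath (f h) (fun i => F i h)] |}.

Lemma perm_castE m n (e : m = n) (f : perm_data m) h (x : 'I_n) :
  (ocast e f : perm_data n) h x = f h (cast_ord (esym e) x) :> nat.
Proof. by case: _ / e x => x; rewrite cast_ord_id. Qed.

Lemma nat_cast_ord m n (e : m = n) (i : 'I_m) : cast_ord e i = i :> nat.
Proof. by []. Qed.

Lemma perm_laws : operad_laws (fun n (x y : perm_data n) => x = y).
Proof.
split.
- by move=> n f; apply/ffunP => h; rewrite ffunE mulg1.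
- by move=> n g g' f; apply/ffunP => h; rewrite !ffunE mulgA.
- by move=> n f; apply/ffunP => h; rewrite ffunE mul1g.
- by move=> n f s t; apply/ffunP => h; rewrite !ffunE mulgA.
- by move=> n g f s; apply/ffunP => h; rewrite !ffunE.
- by move=> g; apply/ffunP => h; rewrite !ffunE.
- move=> n k g f F; apply/ffunP => h; rewrite !ffunE.
  apply/permP => x; have [j [i ->]] := Rank_surj x; apply: ord_inj.
  by rewrite !wreathE ffunE.
- move=> n f e; apply/ffunP => h; apply/permP => x; apply: ord_inj.
  rewrite perm_castE ffunE; have [j [i ->]] := Rank_surj x.
  rewrite wreathE big_pred0 => [|l]; last by rewrite !ord1 ltnn.
  rewrite add0n; congr (nat_of_ord (f h _)); apply: ord_inj.
  by rewrite nat_cast_ord tagnat.RankEsum big_pred0 // => l; rewrite !ord1.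
- move=> n f e; apply/ffunP => h; apply/permP => x; apply: ord_inj.
  rewrite perm_castE ffunE; have [j [i ->]] := Rank_surj x.
  rewrite wreathE sum_lt_perm ord1 addn0.
  congr (nat_of_ord (f h _)); apply: ord_inj.
  rewrite nat_cast_ord tagnat.RankEsum (ord1 i) addn0 -[LHS](congr1 val (perm1 j)) /=.
  by rewrite -sum_lt_perm; apply: eq_bigl => l; rewrite !perm1.
- move=> n k l x y z e; apply/ffunP => h; apply/permP => u; apply: ord_inj.
  rewrite perm_castE; have [v [a ->]] := Rank_surj u.
  have [j [i vE]] := Rank_surj v; case: _ / (esym vE) in a *.
  have -> : cast_ord (esym e) (tagnat.Rank (tagnat.Rank j i) a) =
            tagnat.Rank j (tagnat.Rank i a).
    apply: ord_inj; rewrite nat_cast_ord [LHS]tagnat.RankEsum Rank_offset.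
    by rewrite [RHS]tagnat.RankEsum [X in _ = _ + X]tagnat.RankEsum addnA.
  rewrite !ffunE [LHS]wreathE [RHS]wreathE !ffunE.
  by rewrite [X in _ = _ + X]wreathE wreath_offset addnA.
- move=> n k f s F e; apply/ffunP => h; apply/permP => x; apply: ord_inj.
  rewrite !ffunE permM perm_castE ffunE; have [j [i ->]] := Rank_surj x.
  rewrite wreathE.
  have -> : cast_ord (esym e) (block_perm (fun i => k (s i)) s (tagnat.Rank j i)) =
            tagnat.Rank (s j) i.
    apply: ord_inj; rewrite nat_cast_ord block_permE tagnat.RankEsum; congr (_ + _).
    by rewrite [RHS](reindex_inj (@perm_inj _ s)).
  rewrite wreathE [in RHS](reindex_inj (@perm_inj _ s)) /=; congr (_ + _).
  by apply: eq_bigl => l; rewrite !permM.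
- move=> n k f F t; apply/ffunP => h; apply/permP => x; apply: ord_inj.
  rewrite !ffunE permM; have [j [i ->]] := Rank_surj x.
  by rewrite block_sumE !wreathE ffunE permM.
Qed.

Definition P_operad : operad G := Operad perm_laws.

End Permutativity.

Definition swap2 : 'S_2 := tperm ord0 ord_max.

Definition P_e (G : finGroupType) : P_operad G 0 := [ffun => 1%g].

Definition P_otimes (G : finGroupType) : P_operad G 2 := [ffun => 1%g].

Definition P_boxtimes (G : finGroupType) : P_operad G 2 :=
  [ffun h => if h == 1%g then 1%g else swap2].

Inductive Q_generator (G : finGroupType) : forall n, P_operad G n -> Prop :=
| Q_e : Q_generator (P_e G)
| Q_otimes : Q_generator (P_otimes G)
| Q_boxtimes : Q_generator (P_boxtimes G).

Definition Q_operad (G : finGroupType) : operad G :=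
  generated_suboperad (@Q_generator G).

Inductive symbol : nat -> Type :=
| sym_e : symbol 0
| sym_otimes : symbol 2
| sym_boxtimes : symbol 2.

Section Presentation.

Variables (G : finGroupType) (g : G).

Local Notation F := (free_operad G symbol).
Local Notation one := (@opid G F).
Local Notation e := (free_gen G sym_e).
Local Notation otimes := (free_gen G sym_otimes).
Local Notation boxtimes := (free_gen G sym_boxtimes).

(** Pitfall: [comp2] produces the arities [1 + 0], [0 + 1], [2 + 1], [1 + 2],
    which are only convertible to the arities displayed here. *)
Inductive Q_relation : forall n, F n -> F n -> Prop :=
| unit_boxtimes_r : @Q_relation 1 (comp2 boxtimes one e) one
| unit_boxtimes_l : @Q_relation 1 (comp2 boxtimes e one) one
| unit_otimes_r : @Q_relation 1 (comp2 otimes one e) one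
| unit_otimes_l : @Q_relation 1 (comp2 otimes e one) one
| assoc_otimes : @Q_relation 3
    (comp2 otimes otimes one) (comp2 otimes one otimes)
| assoc_boxtimes : @Q_relation 3
    (comp2 boxtimes boxtimes one) (comp2 boxtimes one boxtimes)
| act_boxtimes : @Q_relation 2 (gact g boxtimes) (sact boxtimes swap2)
| act_otimes : @Q_relation 2 (gact g otimes) otimes
| act_e : @Q_relation 0 (gact g e) e.

End Presentation.

(* Main.v *)
From mathcomp Require Import all_boot all_order all_fingroup.
From mathcomp Require Import boolp zify.
Require Import Defs.

(** By the group action relations and equivariance, every element of the
    presented operad is a tree in [otimes] and [boxtimes] composed with a
    permutation [s] of the leaves. Its image [f] in [P] has [f(1) = s], and
    [f(g) s^-1] is the separable permutation obtained by reading [otimes] as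
    direct sum and [boxtimes] as skew sum, so it remains to see that a separable
    permutation determines its tree up to associativity and units. A tree with
    root [u + v] has a permutation that splits after the leaves of [u], and every
    tree of a permutation that splits at a given place can be reassociated so
    that its root splits it there; two trees with the same permutation can thus
    be compared by induction. *)

Set Implicit Arguments.
Unset Strict Implicit.
Unset Printing Implicit Defensive.

(** * Trees and separable permutations *)

(** [Leaf] stands for the operadic identity, [Nil] for [e], and a node for [otimes] if its label is
    [true], for [boxtimes] if it is [false]. *)
Inductive tree := Leaf | Nil | Node of bool & tree & tree.

Fixpoint arity (t : tree) : nat :=
  match t with
  | Leaf => 1
  | Nil => 0
  | Node _ u v => arity u + arity v
  end.

Inductive teq : tree -> tree -> Prop :=
| teq_refl t : teq t t
| teq_sym t u : teq t u -> teq u t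
| teq_trans t u v : teq t u -> teq u v -> teq t v
| teq_node b t t' u u' : teq t t' -> teq u u' -> teq (Node b t u) (Node b t' u')
| teq_assoc b t u v : teq (Node b (Node b t u) v) (Node b t (Node b u v))
| teq_nill b t : teq (Node b Nil t) t
| teq_nilr b t : teq (Node b t Nil) t.

Definition shift m (s : seq nat) := map (addn m) s.

(* Direct sum ([b = true]) and skew sum ([b = false]) of permutations written
   as sequences of values. *)
Definition dsum (b : bool) (s t : seq nat) :=
  if b then s ++ shift (size s) t else shift (size t) s ++ t.

(** Nodes labelled [c] are read as direct sums, the others as skew sums. The parameter makes the
    labels interchangeable, so that the root under study can always be taken to be a direct sum. *)
Fixpoint code (c : bool) (t : tree) : seq nat :=
  match t with
  | Leaf => [:: 0]
  | Nil => [::]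
  | Node b u v => dsum (b == c) (code c u) (code c v)
  end.

Lemma shift0 s : shift 0 s = s.
Proof. exact: map_id. Qed.

Lemma shift_shift m n s : shift m (shift n s) = shift (m + n) s.
Proof. by rewrite /shift -seq.map_comp; apply: eq_map => v /=; rewrite addnA. Qed.

Lemma shift_cat m s t : shift m (s ++ t) = shift m s ++ shift m t.
Proof. exact: map_cat. Qed.

Lemma shift_inj m : injective (shift m).
Proof. exact/inj_map/addnI. Qed.

Lemma size_dsum b s t : size (dsum b s t) = size s + size t.
Proof. by case: b; rewrite size_cat size_map. Qed.

Lemma size_code c t : size (code c t) = arity t.
Proof. by elim: t => //= b u <- v <-; rewrite size_dsum. Qed.

Lemma dsumA b s t u : dsum b (dsum b s t) u = dsum b s (dsum b t u).
Proof.
by case: b;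
  rewrite /= !size_cat !size_map !shift_cat !shift_shift catA // addnC.
Qed.

Lemma dsum0s b s : dsum b [::] s = s.
Proof. by case: b; rewrite //= shift0. Qed.

Lemma dsums0 b s : dsum b s [::] = s.
Proof. by case: b; rewrite //= cats0 ?shift0. Qed.

Lemma code_teq c t u : teq t u -> code c t = code c u.
Proof.
elim=> //= {t u}.
- by move=> t u v _ -> _ ->.
- by move=> b t t' u u' _ -> _ ->.
- by move=> b t u v; rewrite dsumA.
- by move=> b t; rewrite dsum0s.
- by move=> b t; rewrite dsums0.
Qed.

Lemma arity_teq t u : teq t u -> arity t = arity u.
Proof. by rewrite -!(size_code true) => /code_teq ->. Qed.

Lemma mem_shift m s v : (v \in shift m s) = (m <= v) && (v - m \in s).
Proof.
apply/mapP/andP => [[w ws ->]|[le_mv vs]]; first by rewrite leq_addr addKn.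
by exists (v - m); rewrite // subnKC.
Qed.

Lemma mem_code c t v : (v \in code c t) = (v < arity t).
Proof.
elim: t v => [|//|b t IHt u IHu] v; first by rewrite inE; case: v.
by rewrite /= /dsum; case: (b == c);
  rewrite mem_cat mem_shift !size_code IHt IHu; lia.
Qed.

Lemma code_compl c t :
  code (~~ c) t = [seq (arity t).-1 - v | v <- code c t].
Proof.
elim: t => //= b t -> u ->.
have -> : (b == ~~ c) = ~~ (b == c) by case: b c => [] [].
have Et v : v \in code c t -> v < arity t by rewrite mem_code.
have Eu v : v \in code c u -> v < arity u by rewrite mem_code.
rewrite /dsum; case: (b == c) => /=;
  rewrite map_cat /shift -!seq.map_comp !size_map !size_code;
  congr (_ ++ _); apply/eq_in_map => v /=; try (move=> /Et); try (move=> /Eu); lia.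
Qed.

(** The two readings of a tree determine each other by complementing values, which exchanges direct
    and skew sums. *)
Lemma code_eq c c' t u : code c t = code c u -> code c' t = code c' u.
Proof.
move=> E; have Ea : arity t = arity u by rewrite -!(size_code c) E.
have [->//|ne] := eqVneq c' c.
have -> : c' = ~~ c by case: c c' ne {E} => [] [].
by rewrite !code_compl E Ea.
Qed.

(** * Recovering a tree from its code *)

Definition splits m (s : seq nat) :=
  all (fun v => v < m) (take m s) && all (fun v => m <= v) (drop m s).

Lemma splits_dsum c t u : splits (arity t) (code c (Node c t u)).
Proof.
rewrite /splits /= eqxx /dsum -(size_code c t) take_size_cat // drop_size_cat //.
apply/andP; split; apply/allP => v; first by rewrite mem_code size_code.
by rewrite mem_shift => /andP[].
Qed.

Lemma teq_Nil t : arity t = 0 -> teq t Nil.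
Proof.
elim: t => // [_|b t IHt u IHu /eqP]; first exact: teq_refl.
rewrite addn_eq0 => /andP[/eqP/IHt Et /eqP/IHu Eu].
exact: teq_trans (teq_node b Et Eu) (teq_nill b Nil).
Qed.

Lemma teq_node0l b t u : arity t = 0 -> teq (Node b t u) u.
Proof.
move=> /teq_Nil Et.
exact: teq_trans (teq_node b Et (teq_refl u)) (teq_nill b u).
Qed.

Lemma teq_node0r b t u : arity u = 0 -> teq (Node b t u) t.
Proof.
move=> /teq_Nil Eu.
exact: teq_trans (teq_node b (teq_refl t) Eu) (teq_nilr b t).
Qed.

(** If the root has label [c], the splitting restricts to the child in which [m] falls, and
    reassociation lifts the cut of that child to the root. Otherwise, if both children have leaves,
    the code is a proper skew sum, which splits only at its two ends, where [Nil] serves as one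
    half. *)
Lemma teq_split c t m : m <= arity t -> splits m (code c t) ->
  exists u v, arity u = m /\ teq t (Node c u v).
Proof.
have triv0 t' : exists u v, arity u = 0 /\ teq t' (Node c u v).
  by exists Nil, t'; split=> //; apply: teq_sym; apply: teq_nill.
have trivn t' : exists u v, arity u = arity t' /\ teq t' (Node c u v).
  by exists t', Nil; split=> //; apply: teq_sym; apply: teq_nilr.
elim: t m => [||b t IHt u IHu] m.
- by case: m => [|[|//]] _ _; [apply: triv0 | apply: (trivn Leaf)].
- by case: m => [|//] _ _; apply: triv0.
have [/eqP bc|bc] := boolP (b == c).
  rewrite {}bc /= eqxx /splits /dsum take_cat drop_cat !size_code => le_m.
  case: (ltnP m (arity t)) => [lt_m|ge_m].
    rewrite all_cat => /and3P[s1 s2 _].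
    have [t1 [t2 [at1 Et]]] := IHt m (ltnW lt_m) (introT andP (conj s1 s2)).
    exists t1, (Node c t2 u); split=> //.
    exact: teq_trans (teq_node c Et (teq_refl u)) (teq_assoc _ _ _ _).
  rewrite -map_take -map_drop all_cat !all_map => /andP[/andP[_ s1] s2].
  have [||u1 [u2 [au1 Eu]]] := IHu (m - arity t); first lia.
    by apply/andP; split; [move: s1 | move: s2]; apply/sub_all => v /=; lia.
  exists (Node c t u1), u2; split; first by rewrite /= au1; lia.
  apply: teq_trans (teq_node c (teq_refl t) Eu) _.
  exact/teq_sym/teq_assoc.
(* The root now has the other label. A child without leaves is removed up to [teq], which keeps the
   code. *)
have [t0|t_gt0] := posnP (arity t).
  have E := teq_node0l b u t0; rewrite (arity_teq E) (code_teq c E) => le_m.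
  by move=> /(IHu _ le_m)[v [w [av Ev]]]; exists v, w;
    split; [|apply: teq_trans Ev].
have [u0|u_gt0] := posnP (arity u).
  have E := teq_node0r b t u0; rewrite (arity_teq E) (code_teq c E) => le_m.
  by move=> /(IHt _ le_m)[v [w [av Ev]]]; exists v, w;
    split; [|apply: teq_trans Ev].
have [->|m_gt0 le_m] := posnP m; first by move=> *; apply: triv0.
have [->|ne_m] := eqVneq m (arity (Node b t u)); first by move=> *; apply: trivn.
rewrite /splits => /andP[/allP s1 /allP s2].
have {}s1 v : v \in take m (code c (Node b t u)) -> v < m by apply: s1.
(* The values of [t] are those [>= arity u] and come first: if [m] lies within
   [t] then [0] comes after position [m], otherwise the maximum comes before. *)
move: s1 s2; rewrite /= (negbTE bc) /dsum take_cat drop_cat size_map !size_code.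
case: ltnP => [lt_m _ s2|ge_m s1 _].
  suff: m <= 0 by lia.
  by apply: s2; rewrite mem_cat mem_code u_gt0 orbT.
have: (arity t + arity u).-1 < m.
  apply: s1; rewrite mem_cat mem_shift mem_code; lia.
by move: ne_m le_m => /=; lia.
Qed.

(** Removing leafless children leads to a root whose children both have fewer leaves than [t], as an
    induction on the arity needs. *)
Lemma teq_proper t : 1 < arity t ->
  exists b u v, [/\ 0 < arity u, 0 < arity v & teq t (Node b u v)].
Proof.
elim: t => // b t IHt u IHu a_gt1.
have [t0|t_gt0] := posnP (arity t).
  have E := teq_node0l b u t0; move: a_gt1; rewrite (arity_teq E).
  move=> /IHu[b' [v [w [av aw Ev]]]]; exists b', v, w; split=> //.
  exact: teq_trans Ev.
have [u0|u_gt0] := posnP (arity u).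
  have E := teq_node0r b t u0; move: a_gt1; rewrite (arity_teq E).
  move=> /IHt[b' [v [w [av aw Ev]]]]; exists b', v, w; split=> //.
  exact: teq_trans Ev.
by exists b, t, u; split=> //; apply: teq_refl.
Qed.

Lemma teq_Leaf t : arity t = 1 -> teq t Leaf.
Proof.
elim: t => // [_|b t IHt u IHu /= a1]; first exact: teq_refl.
have [t0|t_gt0] := posnP (arity t).
  by apply: teq_trans (teq_node0l b u t0) (IHu _); lia.
by apply: teq_trans (teq_node0r b t _) (IHt _); lia.
Qed.

Lemma teq_code c t t' : code c t = code c t' -> teq t t'.
Proof.
(* The induction is on the number of leaves, since reassociation yields children that are not
   subterms. *)
move: {2}(arity t).+1 (ltnSn (arity t)) => n.
elim: n c t t' => // n IHn c t t' lt_tn E.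
have Ea : arity t = arity t' by rewrite -!(size_code c) E.
case: (ltngtP (arity t) 1) => [t0|/teq_proper|t1].
- have {}t0 : arity t = 0 by lia.
  exact: teq_trans (teq_Nil t0) (teq_sym (teq_Nil (esym (etrans (esym t0) Ea)))).
- move=> [b [u [v [u_gt0 v_gt0 Et]]]].
  (* With [b] read as the direct sum, the common code splits after the leaves of [u]. So [t'] can be
     reassociated to the same root label and the same cut, and the codes of the children are
     compared separately. *)
  have {}E := code_eq b E; move: (splits_dsum b u v); rewrite -(code_teq b Et) E.
  move=> /teq_split[|u' [v' [au' Et']]].
    by rewrite -Ea (arity_teq Et) leq_addr.
  have Auv := arity_teq Et.
  move/eqP: E; rewrite (code_teq b Et) (code_teq b Et') /= eqxx /dsum.
  rewrite eqseq_cat !size_code ?au' // => /andP[/eqP Eu /eqP/shift_inj Ev].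
  apply: teq_trans Et (teq_trans _ (teq_sym Et')).
  by apply: teq_node; [apply: IHn Eu | apply: IHn Ev]; move: Auv => /=; lia.
- exact: teq_trans (teq_Leaf t1) (teq_sym (teq_Leaf (etrans (esym Ea) t1))).
Qed.

(** * Composition on the total space of an operad *)

Definition total_space (G : finGroupType) (O : operad_data G) := {n & O n}.

Definition tot (G : finGroupType) (O : operad_data G) n (x : O n) : total_space O :=
  existT _ n x.

Lemma tot_cast (G : finGroupType) (O : operad_data G) m n (e : m = n) (x : O m) :
  tot (ocast e x) = tot x.
Proof. by case: _ / e. Qed.

Lemma tot_inj (G : finGroupType) (O : operad_data G) n : injective (@tot G O n).
Proof.
move=> x y E; have := projT2_eq E.
by rewrite (eq_irrelevance (projT1_eq E) erefl).
Qed.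

(* Composition on the total space, with a family of inputs indexed by all of
   [nat]: only the first [tag X] entries matter, and arities no longer occur
   in types. *)
Definition tcomp (G : finGroupType) (O : operad_data G) (X : total_space O)
    (Y : nat -> total_space O) : total_space O :=
  tot (comp (tagged X) (fun i : 'I_(tag X) => tagged (Y i))).

Inductive tsym (G : finGroupType) (O : operad_data G) :
    total_space O -> total_space O -> Prop :=
  TSym n (x : O n) (s : 'S_n) : tsym (tot x) (tot (sact x s)).

Definition tgact (G : finGroupType) (O : operad_data G) (h : G)
    (X : total_space O) : total_space O := tot (gact h (tagged X)).

Section Total.

Variables (G : finGroupType) (O : operad G).

Let L := opP O.
Let one : total_space O := tot (@opid G O).

(** Families are compared in the total space, so that one rewriting changes the arities and the
    elements over them together. *)
Lemma eq_tcomp_fam n (x : O n) (Y Y' : 'I_n -> total_space O) : Y =1 Y' ->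
  tot (comp x (fun i => tagged (Y i))) = tot (comp x (fun i => tagged (Y' i))).
Proof. by move=> /funext ->. Qed.

Arguments eq_tcomp_fam {n} x Y Y'.

Lemma eq_tcomp (X : total_space O) (Y Y' : nat -> total_space O) :
  (forall i, i < tag X -> Y i = Y' i) -> tcomp X Y = tcomp X Y'.
Proof.
move=> E; apply: (eq_tcomp_fam _ (fun i => Y i) (fun i => Y' i)).
by move=> i; apply: E.
Qed.

(** The default [one] never enters the composite [tot_comp], but it is a normal element: closure of
    normal elements under [tcomp] asks for normality at every index. *)
Definition nat_fam n (Y : 'I_n -> total_space O) (i : nat) : total_space O :=
  if insub i is Some u then Y u else one.

Lemma nat_famE n (Y : 'I_n -> total_space O) (i : 'I_n) : nat_fam Y i = Y i.
Proof. by rewrite /nat_fam valK. Qed.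

Lemma tot_comp n (k : 'I_n -> nat) (x : O n) (y : forall i, O (k i)) :
  tot (comp x y) = tcomp (tot x) (nat_fam (fun i => tot (y i))).
Proof.
apply: (eq_tcomp_fam x (fun i => tot (y i))
   (fun i => nat_fam (fun i => tot (y i)) i)) => i.
by rewrite nat_famE.
Qed.

Lemma tcomp1l (Y : nat -> total_space O) : tcomp one Y = Y 0.
Proof.
transitivity (tot (comp opid (fun _ : 'I_1 => tagged (Y 0)))).
  apply: (eq_tcomp_fam opid (fun i : 'I_1 => Y i)
    (fun i : 'I_1 => Y 0)) => i; by rewrite ord1.
have e : tag (Y 0) = \sum_(i < 1) tag (Y 0) by rewrite big_ord1.
by rewrite (law_idl L _ e) tot_cast; case: (Y 0).
Qed.

Lemma tcomp1r (X : total_space O) : tcomp X (fun=> one) = X.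
Proof.
case: X => n x.
have e : n = \sum_(i < n) 1 by rewrite sum_nat_const card_ord muln1.
by rewrite /tcomp /= (law_idr L x e) tot_cast.
Qed.

Lemma tcomp0 (X : total_space O) Y : tag X = 0 -> tcomp X Y = X.
Proof. by move=> X0; rewrite -[RHS]tcomp1r; apply: eq_tcomp => i; rewrite X0. Qed.

(** The inputs of the [i]-th factor start at the total arity of the preceding factors, the offset in
    the value of [tagnat.Rank]. *)
Lemma tcompA (X : total_space O) (Y Z : nat -> total_space O) :
  tcomp (tcomp X Y) Z =
  tcomp X (fun i => tcomp (Y i) (fun j => Z (\sum_(l < i) tag (Y l) + j))).
Proof.
case: X => n x; rewrite /tcomp /=.
pose rank := @tagnat.Rank n (fun i => tag (Y i)).
have e : \sum_(i < n) \sum_(j < tag (Y i)) tag (Z (rank i j)) =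
   \sum_(u < \sum_(i < n) tag (Y i)) tag (Z u) 
  by rewrite sum_Rank.
rewrite (law_assoc L x (fun i : 'I_n => tagged (Y i)) (fun u => tagged (Z u)) e).
rewrite tot_cast.
apply: (eq_tcomp_fam x
  (fun i => tot (comp (tagged (Y i)) (fun j => tagged (Z (rank i j)))))
  (fun i : 'I_n => tcomp (Y i) (fun j => Z (\sum_(l < i) tag (Y l) + j)))).
move=> i; apply: (eq_tcomp_fam _ (fun j => Z (rank i j))
  (fun j : 'I_(tag (Y i)) => Z (\sum_(l < i) tag (Y l) + j))) => j.
rewrite /rank tagnat.RankEsum; congr (Z (_ + _)).
by rewrite (big_ord_widen n (fun l => tag (Y l))) // ltnW.
Qed.

Lemma tsym_refl (X : total_space O) : tsym X X.
Proof.
case: X => n x; have := TSym x 1%g; rewrite (law_sact1 L); exact.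
Qed.

Lemma tsymP (X Y : total_space O) :
  tsym X Y -> exists s, Y = tot (sact (tagged X) s).
Proof. by case=> n x s; exists s. Qed.

Lemma tsym_trans (Y X Z : total_space O) : tsym X Y -> tsym Y Z -> tsym X Z.
Proof.
move=> XY /tsymP[t ->]; case: XY t => n x s t.
by rewrite /= -(law_sactM L); apply: TSym.
Qed.

Lemma tsym_tgact h (X Y : total_space O) : tsym X Y -> tsym (tgact h X) (tgact h Y).
Proof.
by case=> n x s; rewrite /tgact /= (law_gsact L); apply: TSym.
Qed.

Lemma tgact_comp h (X : total_space O) (Y : nat -> total_space O) :
  tgact h (tcomp X Y) = tcomp (tgact h X) (fun i => tgact h (Y i)).
Proof. by rewrite /tgact /= (law_gcomp L). Qed.

Lemma tsym_tcompr (X : total_space O) (Y Y' : nat -> total_space O) :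
  (forall i, tsym (Y i) (Y' i)) -> tsym (tcomp X Y) (tcomp X Y').
Proof.
move=> S; case: X => n x.
pose s i := sval (cid (tsymP (S i))).
have -> : Y' = (fun i => tot (sact (tagged (Y i)) (s i))).
  by apply/funext => i; rewrite /s; case: cid.
rewrite /tcomp /= (law_equivr L); exact: TSym.
Qed.

(** A permutation of the outer element becomes a block permutation of the composite once the inputs
    are reordered. Each entry of [Y'] is an entry of [Y], so properties shared by all inputs
    survive. *)
Lemma tsym_tcompl (X X' : total_space O) (Y : nat -> total_space O) :
  tsym X X' ->
  exists2 Y', forall i, exists j, Y' i = Y j & tsym (tcomp X Y') (tcomp X' Y).
Proof.
case=> n x s.
(* Equivariance requires [Y' (s i) = Y i], hence the inverse. *)
pose Y' i := if insub i is Some u then Y ((s^-1)%g (u : 'I_n)) else Y i.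
exists Y'; first by move=> i; rewrite /Y'; case: insub => [u|]; eexists.
have e : \sum_(i < n) tag (Y' i) = \sum_(i < n) tag (Y' (s i)).
  by rewrite (reindex_inj (@perm_inj _ s)).
have := @law_equivl _ _ _ L n _ x s (fun i : 'I_n => tagged (Y' i)) e.
have E : tot (comp (sact x s) (fun i => tagged (Y' (s i)))) =
   tcomp (tot (sact x s)) Y.
  apply: (eq_tcomp_fam (sact x s) (fun i => Y' (s i)) (fun i => Y i)).
  by move=> i; rewrite /Y' valK permK.
move=> E'; rewrite -E E'.
have -> : tcomp (tot x) Y' = tot (ocast e (comp x (fun i : 'I_n => tagged (Y' i)))).
  by rewrite tot_cast.
exact: TSym.
Qed.

End Total.

(** * Normal forms *)

Definition pair_fam (T : Type) (x y : T) (i : nat) : T := if i == 0 then x else y.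

Section Interp.

Variables (G : finGroupType) (O : operad_data G) (e : O 0) (d : bool -> O 2).

Definition tens (b : bool) (X Y : total_space O) : total_space O :=
  tcomp (tot (d b)) (pair_fam X Y).

Fixpoint interp (t : tree) : total_space O :=
  match t with
  | Leaf => tot opid
  | Nil => tot e
  | Node b u v => tens b (interp u) (interp v)
  end.

Lemma tag_tens b X Y : tag (tens b X Y) = tag X + tag Y.
Proof. by rewrite /= big_ord_recl big_ord1. Qed.

Lemma tag_interp t : tag (interp t) = arity t.
Proof. by elim: t => // b t IHt u IHu; rewrite /interp -/interp tag_tens IHt IHu. Qed.

End Interp.

Lemma tot_comp2 (G : finGroupType) (O : operad G) p q (x : O 2) (y : O p)
    (z : O q) :
  tot (comp2 x y z) = tcomp (tot x) (pair_fam (tot y) (tot z)).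
Proof.
rewrite /comp2 tot_cast tot_comp; apply: eq_tcomp => i lt_i.
rewrite -[i]/(val (Ordinal lt_i)) nat_famE.
by case: i lt_i => [|[|]].
Qed.

Section NormalForm.

Variables (G : finGroupType) (O : operad G) (e : O 0) (d : bool -> O 2).

Local Notation one := (tot (@opid G O)).
Local Notation tens := (tens d).
Local Notation interp := (interp e d).

Hypothesis unitr : forall b, tens b one (tot e) = one.
Hypothesis unitl : forall b, tens b (tot e) one = one.
Hypothesis assoc : forall b, tens b (tot (d b)) one = tens b one (tot (d b)).

Lemma tens_one b : tens b one one = tot (d b).
Proof.
by rewrite -[RHS]tcomp1r; apply: eq_tcomp => i _; rewrite /pair_fam if_same.
Qed.

Lemma tcomp_tens b X Y (Z : nat -> total_space O) :
  tcomp (tens b X Y) Z =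
  tens b (tcomp X Z) (tcomp Y (fun j => Z (tag X + j))).
Proof.
rewrite /tens tcompA; apply: eq_tcomp => -[|[|]] // _.
  by apply: eq_tcomp => i _; rewrite big_ord0.
by apply: eq_tcomp => i _; rewrite big_ord1.
Qed.

Lemma tensA b X Y Z : tens b (tens b X Y) Z = tens b X (tens b Y Z).
Proof.
(* Filling the three inputs of [assoc] with [X], [Y], [Z] gives associativity for arbitrary
   factors. *)
pose W i := if i is j.+1 then pair_fam Y Z j else X.
have := congr1 (fun D => tcomp D W) (assoc b).
rewrite !tcomp_tens !tcomp1l /= => E.
apply: etrans (etrans E _); congr (tens b _ _); apply: eq_tcomp => -[|[|]] //.
Qed.

Lemma tens0r b X : tens b X (tot e) = X.
Proof.
have := congr1 (fun D => tcomp D (fun=> X)) (unitr b).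
by rewrite tcomp_tens !tcomp1l tcomp0.
Qed.

Lemma tens0l b X : tens b (tot e) X = X.
Proof.
have := congr1 (fun D => tcomp D (fun=> X)) (unitl b).
by rewrite tcomp_tens !tcomp1l tcomp0.
Qed.

Lemma interp_teq t u : teq t u -> interp t = interp u.
Proof.
elim=> //= {t u}.
- by move=> t u v _ -> _ ->.
- by move=> b t t' u u' _ -> _ ->.
- by move=> b t u v; apply: tensA.
- by move=> b t; apply: tens0l.
- by move=> b t; apply: tens0r.
Qed.

Definition normal (X : total_space O) := exists t, tsym (interp t) X.

Lemma normal_tsym X Y : normal X -> tsym X Y -> normal Y.
Proof. by move=> [t tX] XY; exists t; apply: tsym_trans XY. Qed.

Lemma normal_tens b X Y : normal X -> normal Y -> normal (tens b X Y).
Proof.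
move=> [t tX] [u uY]; exists (Node b t u); apply: tsym_tcompr => i.
by rewrite /pair_fam; case: eqP.
Qed.

Lemma normal_one : normal one.
Proof. by exists Leaf; apply: tsym_refl. Qed.

Lemma normal_e : normal (tot e).
Proof. by exists Nil; apply: tsym_refl. Qed.

Lemma normal_gen b : normal (tot (d b)).
Proof. by rewrite -tens_one; apply: normal_tens; apply: normal_one. Qed.

(** The permutation of the leaves of [X] is moved past the composition by reordering the inputs,
    which are then grafted onto the leaves of the tree by induction. *)
Lemma normal_tcomp X (Y : nat -> total_space O) :
  normal X -> (forall i, normal (Y i)) -> normal (tcomp X Y).
Proof.
move=> [t tX] nY; have [Y' YY' SY] := tsym_tcompl Y tX.
apply: normal_tsym SY; have {nY YY'} : forall i, normal (Y' i).
  by move=> i; have [j ->] := YY' i.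
elim: t Y' {X Y tX} => [||b t IHt u IHu] Y nY.
- by rewrite tcomp1l.
- by rewrite tcomp0 //; apply: normal_e.
- by rewrite [interp _]/= tcomp_tens; apply: normal_tens; [apply: IHt | apply: IHu].
Qed.

Hypothesis gact_e : forall h, gact h e = e.
Hypothesis gact_d : forall h b, tsym (tot (d b)) (tot (gact h (d b))).

(** The action passes to every node, where [gact h (d b)] is [d b] with permuted inputs; closure
    under composition restores normality. *)
Lemma normal_gact h X : normal X -> normal (tgact h X).
Proof.
move=> [t tX]; apply: normal_tsym (tsym_tgact h tX).
elim: t {tX} => [||b t IHt u IHu].
- by rewrite /tgact /= (law_gopid (opP O)); apply: normal_one.
- by rewrite /tgact /= gact_e; apply: normal_e.
- rewrite [interp _]/= /tens tgact_comp; apply: normal_tcomp => [|i].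
    exact: normal_tsym (normal_gen b) (gact_d h b).
  by rewrite /pair_fam; case: eqP.
Qed.

Lemma normal_suboperad : is_suboperad (fun n (x : O n) => normal (tot x)).
Proof.
split.
- by move=> n h x /(normal_gact h).
- by move=> n x s /normal_tsym; apply; apply: TSym.
- by apply: normal_one.
- move=> n k x y nx ny; rewrite tot_comp; apply: normal_tcomp => // i.
  by rewrite /nat_fam; case: insub => [u|]; [apply: ny | apply: normal_one].
Qed.

Hypothesis gen : forall A : forall n, O n -> Prop, is_suboperad A ->
  A 0 e -> (forall b, A 2 (d b)) -> forall n (x : O n), A n x.

Lemma normal_form n (x : O n) :
  exists t (y : O n) (s : 'S_n), tot y = interp t /\ x = sact y s.
Proof.
have [t] := gen normal_suboperad normal_e normal_gen x.
have [m [z Ez]] : exists m (z : O m), tot z = interp t.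
  by case: (interp t) => m z; exists m, z.
rewrite -Ez => /tsymP[/= s Ex].
have mn : m = n := esym (congr1 (@projT1 _ _) Ex).
by case: _ / mn in x Ex *; exists t, z, s; split=> //; apply: tot_inj.
Qed.

End NormalForm.

(** * Permutations as words *)

Section Words.

Variable G : finGroupType.

Local Notation P := (P_operad G).

Definition P_gen (b : bool) : P 2 := if b then P_otimes G else P_boxtimes G.

(** One-line notation of the permutation at [h], with values in [nat] so that words of different
    arities can be compared and concatenated. *)
Definition word (h : G) (X : total_space P) : seq nat :=
  [seq nat_of_ord ((tagged X : {ffun G -> 'S_(tag X)}) h u)
    | u <- enum 'I_(tag X)].

Lemma size_word h X : size (word h X) = tag X.
Proof. by rewrite size_map size_enum_ord. Qed.

Lemma nth_word h X (u : 'I_(tag X)) :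
  nth 0 (word h X) u = (tagged X : {ffun G -> 'S_(tag X)}) h u.
Proof. by rewrite (nth_map u) ?size_enum_ord // nth_ord_enum. Qed.

Lemma word_inj X Y : (forall h, word h X = word h Y) -> X = Y.
Proof.
move=> E; have : tag X = tag Y by rewrite -(size_word 1%g) E size_word.
case: X Y E => n x [m y] E /= nm; case: _ / nm in y E *.
congr existT; apply/ffunP => h; apply/permP => u; apply: ord_inj.
by have := congr1 (fun s => nth 0 s u) (E h); rewrite !(@nth_word h (existT _ n _)).
Qed.

Lemma word_iota n (x : P n) h :
  word h (tot x) = iota 0 n -> (x : {ffun G -> 'S_n}) h = 1%g.
Proof.
move=> E; apply/permP => u; apply: ord_inj; rewrite perm1.
by rewrite -(@nth_word h (tot x)) E nth_iota.
Qed.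

Lemma nth_word_tcomp h n (x : P n) (Y : nat -> total_space P) (j : 'I_n)
    (i : 'I_(tag (Y j))) :
  nth 0 (word h (tcomp (tot x) Y)) (\sum_(l : 'I_n | l < j) tag (Y l) + i) =
  \sum_(l | (x : {ffun G -> 'S_n}) h l < (x : {ffun G -> 'S_n}) h j) tag (Y l) +
  nth 0 (word h (Y j)) i.
Proof.
rewrite nth_word.
rewrite -(@tagnat.RankEsum n (fun j => tag (Y j))) (@nth_word h (tcomp (tot x) Y)).
by rewrite /= ffunE wreathE.
Qed.

Lemma P_genE b h :
  (P_gen b : {ffun G -> 'S_2}) h = if b || (h == 1%g) then 1%g else swap2.
Proof. by case: b; rewrite ffunE. Qed.

Lemma sum_I2 (p : pred 'I_2) (k : 'I_2 -> nat) :
  \sum_(l | p l) k l =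
  (if p ord0 then k ord0 else 0) + (if p ord_max then k ord_max else 0).
Proof.
rewrite big_mkcond big_ord_recl big_ord1.
by have -> : lift ord0 ord0 = ord_max :> 'I_2 by apply: ord_inj.
Qed.

(** At the unit both generators are the identity and the blocks keep their order. Elsewhere
    [P_boxtimes] is the transposition, which lifts the values of the first block above those of the
    second: a skew sum. *)
Lemma word_tens h b X Y :
  word h (tens P_gen b X Y) = dsum (b || (h == 1%g)) (word h X) (word h Y).
Proof.
have S : size (word h (tens P_gen b X Y)) = tag X + tag Y.
  by rewrite size_word tag_tens.
apply: (@eq_from_nth _ 0) => [|i]; first by rewrite S size_dsum !size_word.
rewrite S => lt_i; have := @nth_word_tcomp h 2 (P_gen b) (pair_fam X Y).
rewrite P_genE /dsum -/(tens P_gen b X Y); set c := b || _ => N.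
case: (ltnP i (tag X)) => [lt_iX|ge_iX].
  have := N ord0 (Ordinal lt_iX); rewrite !sum_I2.
  case: c {N}; rewrite ?perm1 /= ?tpermL ?tpermR /= !addn0 !add0n => ->.
    by rewrite nth_cat size_word lt_iX.
  by rewrite nth_cat size_map !size_word lt_iX (nth_map 0) ?size_word.
have lt_iY : i - tag X < tag Y by lia.
have := N ord_max (Ordinal lt_iY); rewrite !sum_I2.
have ltF : (i < tag X) = false by rewrite ltnNge ge_iX.
case: c {N}; rewrite ?perm1 /= ?tpermL ?tpermR /= !addn0 ?add0n subnKC // => ->.
  by rewrite nth_cat size_word ltF (nth_map 0) ?size_word.
by rewrite nth_cat size_map !size_word ltF.
Qed.

End Words.

(** * Maps of operads *)

Section Maps.

Variables (G : finGroupType) (O O' : operad G) (f : operad_map O O').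

Definition tmap (X : total_space O) : total_space O' := tot (f _ (tagged X)).

Lemma tmap_tcomp X Y : tmap (tcomp X Y) = tcomp (tmap X) (fun i => tmap (Y i)).
Proof. by rewrite /tmap /= map_comp. Qed.

Lemma tmap_tens d d' b X Y : f _ (d b) = d' b ->
  tmap (tens d b X Y) = tens d' b (tmap X) (tmap Y).
Proof.
move=> fd; rewrite /tens tmap_tcomp /tmap /= -fd.
by apply: eq_tcomp => -[|[|]].
Qed.

Lemma tmap_interp e d e' d' t : f _ e = e' -> (forall b, f _ (d b) = d' b) ->
  tmap (interp e d t) = interp e' d' t.
Proof.
move=> fe fd; elim: t => [||b t IHt u IHu].
- by rewrite /tmap /= map_opid.
- by rewrite /tmap /= fe.
- by rewrite [interp _ _ _]/= (tmap_tens _ _ (fd b)) IHt IHu.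
Qed.

Lemma preimage_suboperad (A : forall n, O' n -> Prop) :
  is_suboperad A -> is_suboperad (fun n (x : O n) => A n (f _ x)).
Proof.
move=> AP; split.
- by move=> n h x; rewrite map_gact; apply: sub_gact.
- by move=> n x s; rewrite map_sact; apply: sub_sact.
- by rewrite map_opid; apply: sub_opid.
- by move=> n k x y Ax Ay; rewrite map_comp; apply: sub_comp.
Qed.

Lemma image_suboperad : is_suboperad (fun n (y : O' n) => exists x, f _ x = y).
Proof.
split.
- by move=> n h _ [x <-]; exists (gact h x); rewrite map_gact.
- by move=> n _ s [x <-]; exists (sact x s); rewrite map_sact.
- by exists opid; rewrite map_opid.
- move=> n k _ y [x <-] Iy.
  exists (comp x (fun i => sval (cid (Iy i)))); rewrite map_comp; congr Defs.comp.
  by apply: functional_extensionality_dep => i; case: cid.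
Qed.

Lemma kernel_congruence : is_congruence (fun n (x y : O n) => f _ x = f _ y).
Proof.
split=> //.
- by move=> n x y z -> ->.
- by move=> n h x y E; rewrite !map_gact E.
- by move=> n x y s E; rewrite !map_sact E.
- move=> n k x x' y y' Ex Ey; rewrite !map_comp Ex; congr Defs.comp.
  exact: functional_extensionality_dep.
Qed.

(** The isomorphism is the inverse of [f] on its image; injectivity makes the chosen preimages
    compatible with the operations. *)
Lemma suboperad_isomorphic (A : forall n, O' n -> Prop) (AP : is_suboperad A) :
  (forall n, injective (f n)) -> (forall n (x : O n), A n (f _ x)) ->
  (forall n (y : O' n), A n y -> exists x, f _ x = y) ->
  isomorphic (suboperad AP) O.
Proof.
move=> f_inj Af fA; pose F n (y : suboperad AP n) := sval (cid (fA n _ (svalP y))).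
have FK n y : f _ (F n y) = sval y by rewrite /F; case: cid.
have FP : forall n y x, f _ x = sval y -> F n y = x.
  by move=> n y x E; apply: f_inj; rewrite FK.
unshelve eexists (@OperadMap _ _ _ F _ _ _ _).
- by move=> n h y; apply: FP; rewrite map_gact FK.
- by move=> n y s; apply: FP; rewrite map_sact FK.
- by apply: FP; rewrite map_opid.
- move=> n k x y; apply: FP; rewrite map_comp FK /=; congr Defs.comp.
  by apply: functional_extensionality_dep => i; rewrite FK.
move=> n; exists (fun x => exist _ (f _ x) (Af n x)) => [y|x] /=.
  by apply: sig_sval_inj; rewrite /= FK.
exact: FP.
Qed.

End Maps.

Section QuotientMaps.

Variables (G : finGroupType) (O O' : operad G) (E : congruence O).

Definition quot_proj : operad_map O (quotient_operad E).
Proof.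
exists (fun n x => quot_cls E x) => //.
- by move=> n h x; rewrite -quot_gact.
- by move=> n x s; rewrite -quot_sact.
- by move=> n k x y; rewrite -quot_comp.
Defined.

Lemma quot_lift (f : operad_map O O') :
  (forall n (x y : O n), E n x y -> f _ x = f _ y) ->
  exists f' : operad_map (quotient_operad E) O',
    forall n (x : O n), f' _ (quot_proj _ x) = f _ x.
Proof.
move=> fE; pose F n (q : quotient_operad E n) := f _ (quot_repr E q).
have FE n x : F n (quot_proj _ x) = f _ x by apply/fE/quot_repr_cls.
unshelve eexists (@OperadMap _ _ _ F _ _ _ _).
- by move=> n h q; rewrite -map_gact -FE.
- by move=> n q s; rewrite -map_sact -FE.
- by rewrite -(map_opid f) -FE.
- by move=> n k q r; rewrite -map_comp -FE.
exact: FE.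
Qed.

End QuotientMaps.

Lemma free_operad_ind (G : finGroupType) (S : nat -> Type)
    (A : forall n, free_operad G S n -> Prop) :
  is_suboperad A -> (forall n (s : S n), A n (free_gen G s)) ->
  forall n (x : free_operad G S n), A n x.
Proof.
move=> AP Agen n x; have [t ->] := quot_surj x.
elim: t => {n x} [n s|n h t IH|n t IH s||n k t IH t' IH'].
- exact: Agen.
- by rewrite -quot_gact; apply: (sub_gact AP).
- by rewrite -quot_sact; apply: (sub_sact AP).
- exact: (sub_opid AP).
- by rewrite -quot_comp; apply: (sub_comp AP).
Qed.

(** * Words of interpreted trees *)

Lemma iota_dsum m n : iota 0 (m + n) = dsum true (iota 0 m) (iota 0 n).
Proof. by rewrite iotaD add0n /= size_iota /shift -iotaDl addn0. Qed.

Section Injectivity.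

Variable G : finGroupType.

Local Notation P := (P_operad G).
Local Notation P_interp := (interp (P_e G) (@P_gen G)).

Lemma word_one h : word h (tot (@opid G P)) = [:: 0].
Proof. by rewrite /word /= enum_ordSl /= ffunE perm1 enum_ord0. Qed.

Lemma word_e h : word h (tot (P_e G)) = [::].
Proof. by apply: size0nil; rewrite size_word. Qed.

Lemma word_interp1 t : word 1%g (P_interp t) = iota 0 (arity t).
Proof.
elim: t => [||b t IHt u IHu]; first exact: word_one; first exact: word_e.
by rewrite [P_interp _]/= word_tens IHt IHu eqxx orbT iota_dsum.
Qed.

Lemma word_interp h t : h != 1%g -> word h (P_interp t) = code true t.
Proof.
move=> h_neq1; elim: t => [||b t IHt u IHu]; first exact: word_one; first exact: word_e.
by rewrite [P_interp _]/= word_tens IHt IHu (negbTE h_neq1) orbF /= eqb_id.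
Qed.

End Injectivity.

(** * The presentation *)

(** For [x = sact y s] with [y] an interpreted tree, [f x] takes the value [s] at the unit.
    Cancelling [s] in the value at [g] leaves the code of the tree, which fixes the tree up to [teq]
    and hence [y]. *)
Lemma normal_map_inj (G : finGroupType) (O : operad G) (e : O 0) (d : bool -> O 2)
    (f : operad_map O (P_operad G)) (g : G) :
  g != 1%g -> f _ e = P_e G -> (forall b, f _ (d b) = P_gen G b) ->
  (forall t u, teq t u -> interp e d t = interp e d u) ->
  (forall n (x : O n), exists t (y : O n) (s : 'S_n),
     tot y = interp e d t /\ x = sact y s) ->
  forall n, injective (f n).
Proof.
move=> g_neq1 fe fd teqE nf n x x'.
have [t [y [s [yE ->]]]] := nf n x; have [t' [y' [s' [yE' ->]]]] := nf n x'.
have fy u z : tot z = interp e d u -> tot (f n z) = interp (P_e G) (P_gen G) u.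
  by move=> zE; rewrite -(tmap_interp u fe fd) -zE.
have fy1 u z : tot z = interp e d u -> (f n z : {ffun G -> 'S_n}) 1%g = 1%g.
  move=> zE; apply: word_iota; rewrite (fy _ _ zE) word_interp1 -(tag_interp e d).
  by rewrite -zE.
rewrite !map_sact => /ffunP E.
have ss' : s = s'.
  by have := E 1%g; rewrite !ffunE (fy1 _ _ yE) (fy1 _ _ yE') !mulg1.
have : word g (tot (f n y)) = word g (tot (f n y')).
  apply: eq_map => u /=; have := E g; rewrite !ffunE ss' => /mulgI.
  by move=> ->.
rewrite (fy _ _ yE) (fy _ _ yE') !word_interp // => /teq_code/teqE tt'.
by rewrite ss'; congr sact; apply: tot_inj; rewrite yE yE' tt'.
Qed.

Lemma tmap_comp2 (G : finGroupType) (O O' : operad G) (f : operad_map O O') p q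
    (x : O 2) (y : O p) (z : O q) :
  tot (f _ (comp2 x y z)) =
  tcomp (tot (f _ x)) (pair_fam (tot (f _ y)) (tot (f _ z))).
Proof.
rewrite -[LHS]/(tmap f (tot (comp2 x y z))) tot_comp2 tmap_tcomp.
by apply: eq_tcomp => -[|[|]].
Qed.

Definition P_symbol (G : finGroupType) n (s : symbol n) : P_operad G n :=
  match s with
  | sym_e => P_e G
  | sym_otimes => P_otimes G
  | sym_boxtimes => P_boxtimes G
  end.

Lemma order2_cases (C2 : finGroupType) (g : C2) :
  [set: C2] = <[g]>%g -> #[g]%g = 2 -> forall h, h = 1%g \/ h = g.
Proof.
move=> hgen hord h; have : h \in <[g]>%g by rewrite -hgen inE.
by rewrite (cycle2g hord) !inE => /orP[] /eqP; [left | right].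
Qed.

(** Elements of [P_operad] are determined by their words, so units and associativity reduce to the
    same laws for [dsum]. *)
Lemma Q_relation_P (C2 : finGroupType) (g : C2)
    (f : operad_map (free_operad C2 symbol) (P_operad C2)) :
  [set: C2] = <[g]>%g -> #[g]%g = 2 ->
  (forall n (s : symbol n), f _ (free_gen C2 s) = P_symbol C2 s) ->
  forall n (x y : free_operad C2 symbol n), Q_relation g x y -> f _ x = f _ y.
Proof.
move=> hgen hord fgen n x y R; have C := order2_cases hgen hord.
have g2 : (g * g = 1)%g by rewrite -expg2 -hord expg_order.
have g_neq1 : g != 1%g by rewrite -order_eq1 hord.
have unitr b : tens (P_gen C2) b (tot opid) (tot (P_e C2)) = tot opid.
  by apply: word_inj => h; rewrite word_tens word_e dsums0.
have unitl b : tens (P_gen C2) b (tot (P_e C2)) (tot opid) = tot opid.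
  by apply: word_inj => h; rewrite word_tens word_e dsum0s.
have assoc b : tens (P_gen C2) b (tot (P_gen C2 b)) (tot opid) =
    tens (P_gen C2) b (tot opid) (tot (P_gen C2 b)).
  by apply: word_inj => h; rewrite -tens_one !word_tens dsumA.
case: R.
- apply: (@tot_inj _ _ 1); apply: etrans (@tmap_comp2 _ _ _ f 1 0 _ _ _) _.
  by rewrite map_opid !fgen; apply: (unitr false).
- apply: (@tot_inj _ _ 1); apply: etrans (@tmap_comp2 _ _ _ f 0 1 _ _ _) _.
  by rewrite map_opid !fgen; apply: (unitl false).
- apply: (@tot_inj _ _ 1); apply: etrans (@tmap_comp2 _ _ _ f 1 0 _ _ _) _.
  by rewrite map_opid !fgen; apply: (unitr true).
- apply: (@tot_inj _ _ 1); apply: etrans (@tmap_comp2 _ _ _ f 0 1 _ _ _) _.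
  by rewrite map_opid !fgen; apply: (unitl true).
- apply: (@tot_inj _ _ 3); apply: etrans (@tmap_comp2 _ _ _ f 2 1 _ _ _) _.
  apply: etrans (esym (@tmap_comp2 _ _ _ f 1 2 _ _ _)).
  by rewrite map_opid !fgen; apply: (assoc true).
- apply: (@tot_inj _ _ 3); apply: etrans (@tmap_comp2 _ _ _ f 2 1 _ _ _) _.
  apply: etrans (esym (@tmap_comp2 _ _ _ f 1 2 _ _ _)).
  by rewrite map_opid !fgen; apply: (assoc false).
- rewrite map_gact map_sact !fgen; apply/ffunP => h; rewrite !ffunE.
  (* At the unit both sides are [swap2]; at [g] both are the identity, as [g] and [swap2] are
     involutions. *)
  case: (C h) => ->; rewrite ?mul1g ?g2 ?eqxx (negbTE g_neq1).
    by rewrite mulg1.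
  by rewrite tperm2.
- by rewrite map_gact !fgen; apply/ffunP => h; rewrite !ffunE.
- by rewrite map_gact !fgen; apply/ffunP => h; rewrite !ffunE.
Qed.

Theorem theorem3p6 (C2 : finGroupType) (g : C2)
  (hgen : [set: C2] = <[g]>%g) (hord : #[g]%g = 2) :
  isomorphic (Q_operad C2)
    (quotient_operad (O := free_operad C2 symbol)
       (generated_congruence (Q_relation g))).
Proof.
set F := free_operad C2 symbol; set E := generated_congruence _.
set O := quotient_operad E; pose pr : operad_map F O := quot_proj E.
have C := order2_cases hgen hord.
have g_neq1 : g != 1%g by rewrite -order_eq1 hord.
have [phi [phi_gen _]] := free_operadP (@P_symbol C2).
(* The kernel of [phi] is a congruence containing the relations, hence the generated congruence, so
   [phi] descends to [O]. *)
have [f f_pr] : exists f : operad_map O (P_operad C2),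
    forall n (x : F n), f _ (pr _ x) = phi _ x.
  apply: quot_lift => n x y /(_ (Congruence (kernel_congruence phi))); apply.
  exact: Q_relation_P phi_gen.
have prE n (x y : F n) : Q_relation g x y -> pr _ x = pr _ y.
  by move=> xy; apply/quot_clsP => E' /(_ _ _ _ xy).
pose gen n (s : symbol n) : O n := pr _ (free_gen C2 s).
pose e := gen _ sym_e.
pose d b := gen _ (if b then sym_otimes else sym_boxtimes).
have O_ind A : is_suboperad A -> (forall n (s : symbol n), A n (gen n s)) ->
    forall n (x : O n), A n x.
  move=> AP Agen n x; have [y ->] := quot_surj x.
  exact: (free_operad_ind (preimage_suboperad pr AP)).
have f_gen n (s : symbol n) : f _ (gen n s) = P_symbol C2 s by rewrite f_pr.
(* It remains that [f] is injective, takes values in [Q_operad], and reaches all of it. *)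
apply: (@suboperad_isomorphic _ _ _ f _ (generated_subP (@Q_generator C2))).
- have fd b : f _ (d b) = P_gen C2 b by rewrite f_gen; case: b.
  have unitr b : tens d b (tot opid) (tot e) = tot opid.
    rewrite /tens -(map_opid pr) -tmap_comp2; congr tot.
    by apply: prE; case: b; constructor.
  have unitl b : tens d b (tot e) (tot opid) = tot opid.
    rewrite /tens -(map_opid pr) -tmap_comp2; congr tot.
    by apply: prE; case: b; constructor.
  have assoc b : tens d b (tot (d b)) (tot opid) = tens d b (tot opid) (tot (d b)).
    rewrite /tens -(map_opid pr) -!tmap_comp2; congr tot.
    by apply: prE; case: b; constructor.
  apply: (normal_map_inj g_neq1 (f_gen _ sym_e) fd).
    exact: interp_teq unitr unitl assoc.
  apply: normal_form.
  + move=> h; case: (C h) => ->; first exact: (law_gact1 (opP O)).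
    by rewrite -map_gact; apply: prE; constructor.
  + move=> h b; case: (C h) => ->.
      by rewrite (law_gact1 (opP O)); apply: tsym_refl.
    rewrite -map_gact; case: b.
      by rewrite (prE _ _ _ (act_otimes g)); apply: tsym_refl.
    by rewrite (prE _ _ _ (act_boxtimes g)) map_sact; apply: TSym.
  + move=> A AP Ae Ad; apply: O_ind => // n [] //.
      exact: (Ad true).
    exact: (Ad false).
- apply: O_ind => [|n s].
    exact/preimage_suboperad/generated_subP.
  by rewrite f_gen => A AP XA; apply: XA; case: s; constructor.
(* By minimality: the image of [f] is a suboperad containing the three generators. *)
- move=> n y Qy; apply: (Qy _ (image_suboperad f)).
  move=> m z [].
  + by exists (gen _ sym_e); rewrite f_gen.
  + by exists (gen _ sym_otimes); rewrite f_gen.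
  + by exists (gen _ sym_boxtimes); rewrite f_gen.
Qed.
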